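(* Let $n\ge1$ and $k\ge0$. The number of ad-nilpotent ideals in $\mathcal I^n$ with class of nilpotence $k$ is exactly the same as the number of Dyck paths from $(0,0)$ to $(2n+2,0)$ with height $k+1$.
   Context: Let $\mathfrak g=sl(n+1,\mathbb C)$ with a fixed Cartan subalgebra $\mathfrak h$, positive roots $\Delta^+$, root spaces $\mathfrak g_\alpha$, and Borel subalgebra $\mathfrak b=\mathfrak h\oplus\bigoplus_{\alpha\in\Delta^+}\mathfrak g_\alpha$. $\mathcal I^n$ is the set of ad-nilpotent ideals of $\mathfrak b$, i.e. ideals of $\mathfrak b$ consisting of ad-nilpotent elements. For $\mathfrak i\in\mathcal I^n$ put $\mathfrak i^1=\mathfrak i$, $\mathfrak i^{m}=[\mathfrak i^{m-1},\mathfrak i]$. The class of nilpotence of $\mathfrak i$ is the smallest $m\ge0$ with $\mathfrak i^{m+1}=0$ (so the zero ideal has class $0$, and Abelian ideals are exactly those of class at most $1$). A Dyck path from $(0,0)$ to $(2N,0)$ is a lattice path with step vectors $(1,1)$ and $(1,-1)$ which does not pass below the $x$-axis; its height is the maximum ordinate of its peaks. *)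

(* Defs.v *)
From HB Require Import structures.
From mathcomp Require Import all_boot all_order all_algebra.
From mathcomp Require Import classical_sets cardinality reals.
From mathcomp Require Export complex.

Set Implicit Arguments.
Unset Strict Implicit.
Unset Printing Implicit Defensive.

Import GRing.Theory.
Local Open Scope ring_scope.

Section SpecialLinear.

Variables (F : fieldType) (n : nat).
Local Notation M := 'M[F]_n.+1.
Implicit Types (x y : M) (U V W h i b : {vspace M}).

Definition lie x y : M := x *m y - y *m x.

Fact lie_is_linear x : linear (lie x).
Proof.
move=> a u v; rewrite /lie mulmxDr mulmxDl -scalemxAr -scalemxAl scalerBr.
by rewrite opprD addrACA.
Qed.
HB.instance Definition _ x := GRing.isLinear.Build F M M _ (lie x) (lie_is_linear x).

Lemma lieC x y : lie x y = - lie y x.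
Proof. by rewrite /lie opprB. Qed.

(* sl(n+1, F), as a subspace of the (n+1) x (n+1) matrices *)
Definition sl : {vspace M} := lker (linfun (mxtrace : M -> F^o)).

Lemma mem_sl x : (x \in sl) = (\tr x == 0).
Proof. by rewrite memv_ker lfunE. Qed.

(* [U, V] is the span of all the brackets; see liev_subP *)
Definition liev U V : {vspace M} :=
  <<[seq lie u v | u <- vbasis U, v <- vbasis V]>>%VS.

Lemma liev_subP U V W :
  reflect {in U & V, forall u v, lie u v \in W} (liev U V <= W)%VS.
Proof.
apply: (iffP span_subvP) => [sW u v uU vV | sW _ /allpairsP[[u v] [/= uU vV ->]]].
  rewrite (coord_vbasis vV) linear_sum rpred_sum // => j _.
  rewrite linearZ rpredZ //= lieC rpredN.
  rewrite (coord_vbasis uU) linear_sum rpred_sum // => k _.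
  rewrite linearZ rpredZ //= lieC rpredN; apply: sW.
  by apply/allpairsP; exists ((vbasis U)`_k, (vbasis V)`_j);
    split=> //=; apply: mem_nth; rewrite size_tuple.
by apply: sW; apply: vbasis_mem.
Qed.

Definition ad_nilpotent x :=
  exists m : nat, forall y, y \in sl -> iter m (lie x) y = 0.

Definition ad_semisimple x :=
  exists2 e : seq M, basis_of sl e
    & forall v, v \in e -> exists c : F, lie x v = c *: v.

Definition toral h :=
  [/\ (h <= sl)%VS, liev h h = 0%VS & forall x, x \in h -> ad_semisimple x].

(* Over an algebraically closed field of characteristic 0, the Cartan
   subalgebras of sl(n+1) are the maximal toral subalgebras. *)
Definition cartan h :=
  toral h /\ forall t : {vspace M}, toral t -> (h <= t)%VS -> t = h.

(* the dual space of h *)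
Definition weight h := 'Hom(subvs_of h, F^o).

(* Only a basis of h is tested; see mem_root_space. *)
Definition root_space h (alpha : weight h) : {vspace M} :=
  (sl :&: \bigcap_(j < \dim h)
     passmx.leigenspace (linfun (lie (vbasis h)`_j))
       (alpha (vsproj h (vbasis h)`_j)))%VS.

Lemma mem_root_space h (alpha : weight h) x :
  reflect (x \in sl /\ forall t : subvs_of h, lie (vsval t) x = alpha t *: x)
    (x \in root_space alpha).
Proof.
rewrite memv_cap; apply: (iffP andP) => -[xsl ax]; split=> //.
  move=> t; set e := fun j : 'I_(\dim h) => (vbasis h)`_j.
  have [c et] : exists c, vsval t = \sum_j c j *: e j.
    by eexists; apply: (coord_vbasis (subvsP t)).
  have -> : alpha t = \sum_j c j * alpha (vsproj h (e j)).
    rewrite -[in LHS](vsvalK t) et linear_sum linear_sum /=.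
    by apply: eq_bigr => j _; rewrite !linearZ.
  rewrite lieC et linear_sum -sumrN scaler_suml.
  apply: eq_bigr => j _; rewrite linearZ /= -scalerN -lieC -scalerA.
  congr (_ *: _); move/subv_bigcapP: ax => /(_ j isT).
  rewrite -memvE memv_ker add_lfunE opp_lfunE scale_lfunE id_lfunE lfunE subr_eq0.
  by move/eqP.
apply/subv_bigcapP => j _.
rewrite -memvE memv_ker add_lfunE opp_lfunE scale_lfunE id_lfunE lfunE /=.
rewrite subr_eq0 -ax vsprojK //; apply: vbasis_mem.
by apply: mem_nth; rewrite size_tuple.
Qed.

Definition is_root h (alpha : weight h) :=
  (alpha != 0) && (root_space alpha != 0%VS).

Definition positive_system h (Dp : seq (weight h)) :=
  [/\ forall alpha, is_root alpha = (alpha \in Dp) || (- alpha \in Dp),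
      forall alpha, alpha \in Dp -> - alpha \notin Dp
    & {in Dp &, forall alpha beta,
        is_root (alpha + beta) -> alpha + beta \in Dp}].

Definition borel h (Dp : seq (weight h)) : {vspace M} :=
  (h + \sum_(alpha <- Dp) root_space alpha)%VS.

Definition ad_nilpotent_ideal b i :=
  [/\ (i <= b)%VS, (liev b i <= i)%VS & forall x, x \in i -> ad_nilpotent x].

(* liepow i m is i^(m+1): i^1 = i and i^(m+1) = [i^m, i] *)
Definition liepow i m : {vspace M} := iter m (fun j => liev j i) i.

Definition nilpotence_class i m :=
  liepow i m = 0%VS /\ forall l, (l < m)%N -> liepow i l != 0%VS.

End SpecialLinear.

(* A lattice path is its sequence of steps: true is (1,1), false is (1,-1). *)
Section DyckPaths.

Implicit Type s : seq bool.

Definition ordinate s (t : nat) : int :=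
  \sum_(up <- take t s) (if up then 1 else -1).

Definition dyck s :=
  [forall t : 'I_(size s).+1, 0 <= ordinate s t] && (ordinate s (size s) == 0).

(* The point of abscissa t+1 is a peak: step t goes up and step t+1 exists
   and goes down. *)
Definition peak s (t : nat) := nth false s t && ~~ nth true s t.+1.

(* The absolute value is harmless: ordinates on a Dyck path are nonnegative. *)
Definition dyck_height s : nat :=
  \max_(t < size s | peak s t) `|ordinate s t.+1|%N.

End DyckPaths.

(* Main.v *)
(** After conjugation [h] is the diagonal torus and the Borel subalgebra is the
    algebra of upper triangular traceless matrices, so the ad-nilpotent ideals
    are the spans of the matrix units in an up-closed set S of pairs i < j, and
    the class of nilpotence is the length of the longest chain in S.  The
    border of S is a word in two letters.  Read as the breadth-first code of a
    plane forest with n+1 vertices, its number of levels is the class plus one,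
    whereas a Dyck path is the depth-first code of a plane forest whose number
    of levels is the height of the path.  Both families are counted by
    [stack_words], where a stack of pending vertices may be processed in any
    order. *)

Require Import Defs.
From mathcomp Require Import all_boot all_order all_algebra.
From mathcomp Require Import classical_sets cardinality reals complex.
From HB Require Import structures.
From mathcomp Require Import all_fingroup ring zify.

Set Implicit Arguments.
Unset Strict Implicit.
Unset Printing Implicit Defensive.

Import Order.TTheory GRing.Theory Num.Theory.

(** * Depth-first and breadth-first codes of forests *)

Fixpoint words L : seq (seq bool) :=
  if L is L'.+1 then map (cons true) (words L') ++ map (cons false) (words L')
  else [:: [::]].

Lemma mem_words L w : (w \in words L) = (size w == L).
Proof.
elim: L w => [|L IH] [|b w] //=.
  by rewrite mem_cat; apply/norP; split; apply/negP => /mapP[].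
rewrite mem_cat eqSS -IH; case: b.
  rewrite mem_map; last by move=> ? ? [].
  by rewrite orbC; case: mapP => // -[? _].
rewrite [X in _ || X]mem_map; last by move=> ? ? [].
by case: mapP => // -[? _].
Qed.

Lemma words_uniq L : uniq (words L).
Proof.
elim: L => // L IH; rewrite /= cat_uniq !map_inj_uniq ?IH; try by move=> ? ? [].
by rewrite andbT; apply/hasPn => _ /mapP[w _ ->]; apply/negP => /mapP[].
Qed.

Lemma card_tuple_words L (P : pred (seq bool)) :
  #|[set w : L.-tuple bool | P w]| = count P (words L).
Proof.
rewrite -size_filter cardE -(size_map val); apply/perm_size/uniq_perm.
- by rewrite map_inj_uniq ?enum_uniq //; apply: val_inj.
- by rewrite filter_uniq ?words_uniq.
move=> w; rewrite mem_filter mem_words; apply/mapP/andP.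
  by case=> t; rewrite mem_enum inE => Pt ->; rewrite size_tuple.
by case=> Pw sw; exists (Tuple sw); rewrite // mem_enum inE.
Qed.

Lemma count_wordsS L (P : pred (seq bool)) : count P (words L.+1) =
  count (fun w => P (true :: w)) (words L) +
  count (fun w => P (false :: w)) (words L).
Proof. by rewrite /= count_cat !count_map. Qed.

(* A stack entry [c] is a vertex with at most [c] levels of descendants left: a
   step either closes the top vertex or gives it a new child. [stack_words L s]
   is the number of ways to empty [s] in exactly [L] steps. *)
Fixpoint stack_words L (s : seq nat) : nat :=
  match L, s with
  | 0, _ => nilp s
  | L'.+1, c :: s' => stack_words L' s' +
      (if c is c'.+1 then stack_words L' (c' :: s) else 0)
  | _.+1, [::] => 0
  end.

(* Any entry may be processed first, since steps on distinct entries commute. *)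
Lemma stack_words_mid L c s1 s2 : stack_words L.+1 (s1 ++ c :: s2) =
  stack_words L (s1 ++ s2) +
  (if c is c'.+1 then stack_words L (s1 ++ c' :: c :: s2) else 0).
Proof.
elim: L s1 => [|L IH] [|d s1] //=; first by case: d s1 c => [|d] [|x s1] [|c].
have := IH s1; have := fun d' => IH (d' :: d :: s1).
rewrite /= => H1 ->.
case: d H1 => [|d] H1; case: c IH H1 => [|c] IH H1 //=; rewrite ?addn0 //.
  by have /= -> := H1 d; rewrite addn0.
by have /= -> := H1 d; rewrite addnACA.
Qed.

(** The head of one stack sits somewhere in the other, where [stack_words_mid] may process it first;
    both sides then unfold to permuted stacks. *)
Lemma stack_words_perm L s1 s2 : perm_eq s1 s2 ->
  stack_words L s1 = stack_words L s2.
Proof.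
elim: L s1 s2 => [|L IH] s1 s2 p12.
  by rewrite /= /nilp (perm_size p12).
case: s1 p12 => [|c s1] p12; first by move: p12; rewrite perm_sym => /perm_nilP->.
have /path.splitPr cs2 : c \in s2 by rewrite -(perm_mem p12) mem_head.
case: cs2 p12 => t1 t2 p12; rewrite stack_words_mid.
have p12' : perm_eq s1 (t1 ++ t2).
  by rewrite -(perm_cons c) (permPl p12) -cat1s perm_catCA.
rewrite /= (IH _ _ p12'); case: c p12 => // c p12; congr (_ + _); apply: IH.
by rewrite perm_sym -cat1s perm_catCA /= perm_cons perm_sym.
Qed.

Fixpoint ceiled (k h : nat) (w : seq bool) : bool :=
  match w with
  | [::] => h == 0
  | true :: w' => (h < k) && ceiled k h.+1 w'
  | false :: w' => (0 < h) && ceiled k h.-1 w'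
  end.

(** Depth-first reading: the stack lists the open vertices, from the deepest one to an added root
    with [k] levels below it. The extra step closes that root. *)
Lemma count_ceiled k h L : h <= k ->
  count (ceiled k h) (words L) = stack_words L.+1 (iota (k - h) h.+1).
Proof.
elim: L h => [|L IH] h hk.
  by rewrite /= addn0; case: (k - h) => [|x]; case: h {hk} => // h; rewrite ?addn0.
rewrite count_wordsS [LHS]addnC.
have -> : iota (k - h) h.+1 = (k - h) :: iota (k - h).+1 h by [].
rewrite -[stack_words _ _]/(stack_words L.+1 (iota (k - h).+1 h) +
  (if k - h is c'.+1
   then stack_words L.+1 (c' :: (k - h) :: iota (k - h).+1 h) else 0)).
congr (_ + _).
  case: h hk => [|h] hk; first by rewrite /= count_pred0.
  by rewrite -subSn // subSS; apply: IH (ltnW hk).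
case E: (k - h) => [|c] /=.
  have -> : (h < k) = false by apply/negbTE; rewrite -leqNgt -subn_eq0 E.
  by rewrite count_pred0.
have hk' : h < k by rewrite -subn_gt0 E.
under eq_count => w do rewrite hk' /=.
rewrite IH //; have -> : k - h.+1 = c by rewrite subnS E.
by [].
Qed.

(* Breadth-first reading: [a] vertices of the current level are still open, [b]
   vertices of the next level have been created, and [K] is the number of levels
   allowed below the current one. The closing step of the last vertex is left
   out of the word. *)
Fixpoint bfs (K a b : nat) (w : seq bool) : bool :=
  match w with
  | [::] => (a == 1) && (b == 0)
  | true :: w' => (0 < K) && bfs K a b.+1 w'
  | false :: w' =>
      if a == 1 then (0 < b) && bfs K.-1 b 0 w' else bfs K a.-1 b w'
  end.

(** [stack_words] puts a new child on top, whereas the reading queues it behind the current level;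
    [stack_words_perm] identifies the two orders. *)
Lemma count_bfs K a b L : 0 < a -> (0 < b -> 0 < K) ->
  count (bfs K a b) (words L) = stack_words L.+1 (nseq a K ++ nseq b K.-1).
Proof.
elim: L K a b => [|L IH] K [|a] b // _ bK.
  by rewrite /= addn0; case: a b K {bK} => [|a] [|b] [|K].
rewrite count_wordsS [LHS]addnC.
rewrite -[RHS]/(stack_words L.+1 (nseq a K ++ nseq b K.-1) +
  (if K is c'.+1 then stack_words L.+1 (c' :: nseq a.+1 K ++ nseq b K.-1) else 0)).
congr (_ + _).
  case: a => [|a] /=.
    case: b bK => [|b] bK; first by rewrite count_pred0.
    by rewrite -[count _ _]/(count (bfs K.-1 b.+1 0) (words L)) IH // cats0.
  by rewrite -[count _ _]/(count (bfs K a.+1 b) (words L)) IH.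
case: K bK => [|K] _; first by rewrite /= count_pred0.
rewrite -[LHS]/(count (bfs K.+1 a.+1 b.+1) (words L)) IH //.
apply: stack_words_perm; apply/seq.permP => p.
by rewrite /= !count_cat /= [X in _ + X = _]addnCA [LHS]addnCA.
Qed.

(** Both sides equal [stack_words L.+1 [:: K]]. *)
Lemma count_bfs_ceiled K L :
  count (bfs K 1 0) (words L) = count (ceiled K 0) (words L).
Proof. by rewrite count_bfs // count_ceiled // subn0. Qed.

Lemma bfs_leq K K' (a b : nat) w : K <= K' -> bfs K a b w -> bfs K' a b w.
Proof.
elim: w K K' a b => [|[] w IH] K K' a b //= KK'.
  by case/andP=> K0 /(IH _ K') -> //; rewrite (leq_trans K0).
case: eqP => _; last exact: IH.
by case/andP=> -> /IH -> //; lia.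
Qed.

Lemma ceiled_leq K K' h w : K <= K' -> ceiled K h w -> ceiled K' h w.
Proof.
move=> KK'; elim: w h => [|[] w IH] h //= /andP[Kh /IH ->]; rewrite ?Kh //.
by rewrite (leq_trans Kh).
Qed.

(* [cell w i j]: the (i+1)-st [false] of [w] comes before its (j+1)-st [true] *)
Fixpoint cell (w : seq bool) (i j : nat) : bool :=
  match w with
  | [::] => false
  | true :: w' => if j is j'.+1 then cell w' i j' else false
  | false :: w' => if i is i'.+1 then cell w' i' j else true
  end.

(* For a predicate that is decreasing in its first argument and increasing in the
   second, the first [L] steps of the lattice path bounding its region. *)
Fixpoint border L (p : nat -> nat -> bool) : seq bool :=
  if L is L'.+1 then
    if p 0 0 then false :: border L' (fun i j => p i.+1 j)
    else true :: border L' (fun i j => p i j.+1)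
  else [::].

Lemma size_border L p : size (border L p) = L.
Proof. by elim: L p => //= L IH p; case: ifP => /= _; rewrite IH. Qed.

Lemma eq_border L (p q : nat -> nat -> bool) :
  (forall i j, i + j < L -> p i j = q i j) -> border L p = border L q.
Proof.
elim: L p q => //= L IH p q pq; rewrite pq //.
by case: ifP => _; congr (_ :: _); apply: IH => i j ij; apply: pq; lia.
Qed.

Lemma cellK w : border (size w) (cell w) = w.
Proof. by elim: w => //= -[] w IH; congr (_ :: _). Qed.

(** The bound on [i' + j'] makes the word decide the target cell before it ends; past its end [cell]
    is false by default. *)
Lemma cell_mono w i j i' j' : i' <= i -> j <= j' -> i' + j' < size w ->
  cell w i j -> cell w i' j'.
Proof.
elim: w i j i' j' => [|[] w IH] [|i] [|j] [|i'] [|j'] //= h1 h2 h3 h4;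
  by first [lia | apply: IH h4; lia].
Qed.

(** The corner decides a whole line: by monotonicity row 0 holds if [p 0 0] does, and otherwise
    column 0 fails. Each letter removes one such line. *)
Lemma borderK L (p : nat -> nat -> bool) :
  (forall i j i' j', i' <= i -> j <= j' -> i + j < L -> i' + j' < L ->
    p i j -> p i' j') ->
  forall i j, i + j < L -> cell (border L p) i j = p i j.
Proof.
elim: L p => //= L IH p pmono i j ij; case: ifP => p00.
  case: i ij => [|i] ij /=.
    by apply/esym; apply: pmono p00; lia.
  by apply: IH; [move=> i1 j1 i2 j2 *; apply: (pmono i1.+1 j1) => // | ]; lia.
case: j ij => [|j] ij /=.
  by apply/esym/negbTE; apply: contraFN p00 => pi0; apply: pmono pi0; lia.
by apply: IH; [move=> i1 j1 i2 j2 *; apply: (pmono i1 j1.+1) => // | ]; lia.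
Qed.

(** Every vertex, open or still to be created, is closed once; the successor accounts for the
    omitted last closing. *)
Lemma bfs_count K (a b : nat) w : bfs K a b w -> 0 < a ->
  (count negb w).+1 = a + b + count id w.
Proof.
elim: w K a b => [|[] w IH] K a b /=; first by case/andP=> /eqP-> /eqP->.
  by case/andP=> _ /IH H /H; lia.
case: eqP => [-> /andP[b0 /IH H] _|]; first by have := H b0; lia.
by move=> a1 /IH H a0; suff /H : 0 < a.-1; lia.
Qed.

(** Before the [(j+1)]-st creation only [a + b + j] vertices exist, and one of them must still be
    open. *)
Lemma bfs_cellF K (a b : nat) w (i j : nat) :
  bfs K a b w -> 0 < a -> j < count id w ->
  j + (a + b) <= i.+1 -> ~~ cell w i j.
Proof.
elim: w K a b i j => [|[] w IH] K a b i j //=.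
  case/andP=> _ ok a0; case: j => // j jw ji; apply: IH ok a0 _ _; lia.
case: eqP => [-> /andP[b0 ok] _|a1 ok a0] jw ji.
  by case: i ji => [|i] ji; [lia | apply: IH ok _ _ _; lia].
by case: i ji => [|i] ji; [lia | apply: IH ok _ _ _; lia].
Qed.

Lemma cellT w (i j : nat) : i < count negb w -> count id w <= j -> cell w i j.
Proof.
elim: w i j => [|[] w IH] i j //=.
  by case: j => [|j] iw jw; [lia | apply: IH; lia].
by case: i => [|i] // iw jw; apply: IH; lia.
Qed.

(** * Chains and breadth-first levels *)

Section Chains.
Variables (N : nat) (P : nat -> nat -> bool).

(** The base case tests [x < N] because [bfs_border] also reaches [x = N], the number after the last
    vertex. *)
Fixpoint chain K x : bool :=
  if K is K'.+1 then has (fun y => P x y && chain K' y) (iota 0 N) else x < N.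

Hypothesis Pmono : forall i j i' j',
  i' <= i -> j <= j' -> i < N -> j' < N -> P i j -> P i' j'.
Hypothesis Pdiag : forall i j, j <= i -> j < N -> ~~ P i j.
Hypothesis PN : forall i j, i < N -> N <= j -> P i j.

Lemma chain_lt K x : chain K x -> x < N.
Proof.
case: K => //= K /hasP[y]; rewrite mem_iota add0n => /= yN /andP[Pxy _].
by rewrite ltnNge; apply: contraL Pxy => xN; apply: Pdiag; lia.
Qed.

Lemma chain_mono K x x' : x' <= x -> chain K x -> chain K x'.
Proof.
move=> xx cx; have xN := chain_lt cx.
case: K cx => [|K] /=; first by move=> _; lia.
case/hasP=> y; rewrite mem_iota add0n => /= yN /andP[Pxy cy].
apply/hasP; exists y; rewrite ?mem_iota //= cy andbT.
exact: Pmono Pxy.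
Qed.

(** By [chain_mono] the smallest successor [c] of [e] is the best next vertex. *)
Lemma chainS K e c : (forall y, y < N -> P e y = (c <= y)) ->
  chain K.+1 e = chain K c.
Proof.
move=> Pe /=; apply/hasP/idP => [[y]|cc].
  by rewrite mem_iota add0n => /= yN; rewrite Pe // => /andP[]; apply: chain_mono.
exists c; last by rewrite Pe ?(chain_lt cc) ?leqnn.
by rewrite mem_iota (chain_lt cc).
Qed.

(* [e] is the first vertex of the next level and [c] the first vertex not yet
   created; vertices [y] with [P e y] are those created after the current level is
   closed, so that a level passes exactly when a chain gets one step longer. *)
Lemma bfs_border K e i c : i <= e <= c -> c <= N -> (e < c -> 0 < K) ->
  (forall y, y < c -> ~~ P i y) ->
  bfs K (e - i).+1 (c - e)
    (border (N + N - i - c) (fun x y => P (i + x) (c + y))) = ~~ chain K e.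
Proof.
move=> /andP[ie ec] cN eK Pi.
have [L eL] : exists L, L = N + N - i - c by eexists.
rewrite -eL; elim: L K e i c eL ie ec cN eK Pi => [|L IH] K e i c eL ie ec cN eK Pi.
  (* Here [i = e = c = N]: only the last vertex is open, and its closing is not in the word. *)
  have -> : chain K e = false by apply: contraTF isT => /chain_lt; lia.
  by rewrite /=; lia.
rewrite /= !addn0; case: ifP => Pic.
  have iN : i < N.
    by rewrite ltnNge; apply: contraL Pic => Ni; apply: Pdiag; lia.
  have Pi1 y : y < c -> ~~ P i.+1 y.
    move=> yc; have [i1N|Ni1] := ltnP i.+1 N; last by apply: Pdiag; lia.
    by apply: contra (Pi _ yc); apply: Pmono => //; lia.
  (* If [i = e], this closing ends the level and [c] takes the place of [e]; otherwise only [i]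
     advances. *)
  rewrite [LHS]/= eqSS subn_eq0; case: (leqP e i) => [ei|lt_ie].
    have lt_ec : e < c.
      by rewrite ltnNge; apply: contraL Pic => ce; apply: Pdiag; lia.
    rewrite subn_gt0 lt_ec /=; case: K eK => [/(_ lt_ec)//|K] _.
    rewrite (@chainS K e c) => [|y yN].
      rewrite -(IH K c i.+1 c) //; try lia.
      rewrite subnn; have -> : (c - i.+1).+1 = c - e by lia.
      by congr (bfs _ _ _ _); apply: eq_border => x y _; rewrite -addSnnS.
    have -> : e = i by lia.
    apply/idP/idP => [|cy]; last exact: Pmono Pic.
    by apply: contraTT; rewrite -ltnNge => /Pi.
  rewrite -(IH _ _ i.+1 c) //; try lia.
  have -> : e - i = (e - i.+1).+1 by lia.
  by congr (bfs _ _ _ _); apply: eq_border => x y _; rewrite -addSnnS.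
have lt_cN : c < N.
  rewrite ltnNge; apply: contraFN Pic => Nc; apply: PN => //; lia.
(* With no level left the creation is refused, and [chain 0 e] holds since [e <= c < N]. *)
case: K eK => [|K] eK.
  by rewrite /=; symmetry; apply/negbTE; rewrite negbK; lia.
rewrite -(IH _ _ i c.+1) //; try lia.
  have -> : c.+1 - e = (c - e).+1 by lia.
  rewrite [LHS]/=.
  by congr (bfs _ _ _ _); apply: eq_border => x y _; rewrite -addSnnS.
move=> y; rewrite ltnS leq_eqVlt => /predU1P[->|]; last exact: Pi.
by rewrite Pic.
Qed.

End Chains.

(** * Heights of Dyck paths *)

Lemma ordinate0 w : ordinate w 0 = 0%R.
Proof. by rewrite /ordinate take0 big_nil. Qed.

Lemma ordinate_cons b w t :
  ordinate (b :: w) t.+1 = ((if b then 1 else -1) + ordinate w t)%R.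
Proof. by rewrite /ordinate /= big_cons. Qed.

Lemma ordinateS w t : t < size w ->
  ordinate w t.+1 = (ordinate w t + (if nth false w t then 1 else -1))%R.
Proof.
by move=> tw; rewrite /ordinate (take_nth false) // -cats1 big_cat big_seq1.
Qed.

Lemma ceiledP k h w : h <= k ->
  reflect ((forall t : nat, (t <= size w)%N -> 0 <= h%:Z + ordinate w t <= k%:Z) /\
           h%:Z + ordinate w (size w) = 0)%R
          (ceiled k h w).
Proof.
elim: w h => [|b w IH] h hk.
  apply: (iffP eqP) => [->|[_ /=]]; rewrite ?ordinate0; last lia.
  by split=> // t; rewrite leqn0 => /eqP->; rewrite ordinate0; lia.
pose h' := if b then h.+1 else h.-1.
have eh' : h' = if b then h.+1 else h.-1 by []; clearbody h'.
have -> : ceiled k h (b :: w) = (if b then h < k else 0 < h) && ceiled k h' w.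
  by rewrite eh'; case: (b).
apply: (iffP andP) => [[hb /IH]|[ht h0]].
  case; first by rewrite eh'; move: hb; case: (b); lia.
  move=> ht h0; split=> [[|t] tw|];
    rewrite -?[size (b :: w)]/(size w).+1 ?ordinate0 ?ordinate_cons //=.
  - by lia.
  - by have := ht t tw; move: hb; rewrite eh'; case: (b); lia.
  by move: h0 hb; rewrite eh'; case: (b); lia.
have hb : if b then h < k else 0 < h.
  by have := ht 1 isT; rewrite ordinate_cons ordinate0; case: (b); lia.
split=> //; apply/IH; first by rewrite eh'; move: hb; case: (b); lia.
split=> [t tw|].
  have := ht t.+1 tw; rewrite ordinate_cons.
  by move: hb; rewrite eh'; case: (b); lia.
by move: h0; rewrite /= ordinate_cons; move: hb; rewrite eh'; case: (b); lia.
Qed.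

(** The largest ordinate, when positive, is attained at a peak. *)
Lemma dyck_height_leP k w : dyck w ->
  reflect (forall t : nat, (t <= size w)%N -> ordinate w t <= k%:Z)%R
          (dyck_height w <= k).
Proof.
case/andP=> /forallP wge0 /eqP wend.
apply: (iffP (bigmax_leqP _ _ _)) => [wk|wk t _]; last first.
  have := wge0 (Ordinal (ltn_ord t : t.+1 < (size w).+1)) => /=.
  by have := wk t.+1 (ltn_ord t); lia.
pose F (t : 'I_(size w).+1) := ordinate w t.
have [m _ mmax] := @Order.TotalTheory.arg_maxP _ _ _ ord0 xpredT F isT.
have {}mmax t : t <= size w -> (ordinate w t <= F m)%R.
  by move=> tw; have := mmax (inord t) isT; rewrite /F inordK.
suff mk : (F m <= k%:Z)%R by move=> t tw; apply: le_trans mk; apply: mmax.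
(* A maximum above [k] is positive, so it is at neither end of the path; maximality forces an
   up-step before it and a down-step after it. *)
rewrite leNgt; apply/negP => km.
move: mmax km; rewrite /F; case: m => -[|t] /= tw mmax km.
  by move: km; rewrite ordinate0; lia.
have lt_tw : t < size w by [].
have up : nth false w t.
  by have := mmax t (ltnW lt_tw); rewrite ordinateS //; case: nth => //; lia.
have [Stw|] := ltnP t.+1 (size w); last first.
  by move=> wt; move: km wend; suff -> : t.+1 = size w; lia.
have down : ~~ nth false w t.+1.
  by have := mmax t.+2 Stw; rewrite (ordinateS Stw); case: nth => //; lia.
have := wk (Ordinal lt_tw).
rewrite /peak /= up (set_nth_default false) //= down => /(_ isT); lia.
Qed.

Lemma ceiled_dyck k w : ceiled k 0 w = dyck w && (dyck_height w <= k).
Proof.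
apply/ceiledP/andP => // [[wt w0]|[wD /(dyck_height_leP _ wD) wk]].
  have wD : dyck w.
    apply/andP; split; last by rewrite add0r in w0; rewrite w0.
    by apply/forallP => t; have := wt t (ltn_ord t); rewrite add0r => /andP[].
  split=> //; apply/dyck_height_leP => // t /wt; rewrite add0r => /andP[] //.
have /andP[/forallP wge0 /eqP wend] := wD; rewrite add0r; split=> // t tw.
by rewrite add0r wk // andbT; apply: (wge0 (Ordinal (tw : t < (size w).+1))).
Qed.

(** Exact height is a difference of two nested families, whose sizes agree by [count_bfs_ceiled]. *)
Lemma card_bfs_dyck L K :
  #|[set w : L.-tuple bool | bfs K.+1 1 0 w && ~~ bfs K 1 0 w]| =
  #|[set w : L.-tuple bool | dyck w && (dyck_height w == K.+1)]|.
Proof.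
have -> : [set w : L.-tuple bool | dyck w && (dyck_height w == K.+1)] =
    [set w : L.-tuple bool | ceiled K.+1 0 w] :\:
    [set w : L.-tuple bool | ceiled K 0 w].
  apply/setP=> w; rewrite !inE !ceiled_dyck; case: (dyck w) => //=.
  by rewrite -ltnNge andbC eqn_leq.
have -> : [set w : L.-tuple bool | bfs K.+1 1 0 w && ~~ bfs K 1 0 w] =
    [set w : L.-tuple bool | bfs K.+1 1 0 w] :\:
    [set w : L.-tuple bool | bfs K 1 0 w].
  by apply/setP=> w; rewrite !inE andbC.
rewrite !cardsD; congr (_ - _); first by rewrite !card_tuple_words count_bfs_ceiled.
rewrite !(finset.setIidPr _) ?card_tuple_words ?count_bfs_ceiled //;
  apply/fintype.subsetP => w; rewrite !inE; [exact: ceiled_leq | exact: bfs_leq].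
Qed.

(** * Strict up-closed sets of pairs and their border words *)

Section Staircase.
Variable n : nat.
Implicit Types (S : rel 'I_n.+1).

(** With [(i, j)] standing for the root [e_i - e_j], these are the upper order ideals of the poset
    of positive roots. *)
Definition strict_up S := (forall i j, S i j -> (i < j)%N) /\
  (forall i j i' j' : 'I_n.+1, S i j -> (i' <= i)%N -> (j <= j')%N -> S i' j').

(** The index is shifted as in [liepow]: [m] stands for chains of [m + 1] steps. *)
Fixpoint chain_rel S m : rel 'I_n.+1 :=
  if m is m'.+1 then fun i j => [exists k, S i k && chain_rel S m' k j] else S.

Lemma chain_relSr S m i j k : chain_rel S m i j -> S j k -> chain_rel S m.+1 i k.
Proof.
elim: m i => [|m IH] i ij jk; first by apply/existsP; exists j; apply/andP.
case/existsP: ij => l /andP[il lj]; apply/existsP; exists l; rewrite il.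
exact: IH.
Qed.

Lemma chain_rel_lt S m i j : strict_up S -> chain_rel S m i j -> (i < j)%N.
Proof.
case=> Slt _; elim: m i => [|m IH] i; first exact: Slt.
by case/existsP=> k /andP[/Slt ik /IH]; apply: ltn_trans.
Qed.

(* Columns beyond [n] belong to every region: border words have length 2n+2. *)
Definition staircase S x y : bool :=
  (x < n.+1) && ((n.+1 <= y) || S (inord x) (inord y)).

Lemma staircase_mono S i j i' j' : strict_up S -> i' <= i -> j <= j' ->
  staircase S i j -> staircase S i' j'.
Proof.
move=> [_ Sup] ii jj /andP[iN]; rewrite /staircase (leq_ltn_trans ii iN) /=.
have [//|j'N] := leqP n.+1 j'; rewrite leqNgt (leq_ltn_trans jj j'N) /=.
by move=> Sij; apply: Sup Sij _ _; rewrite !inordK //; lia.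
Qed.

Lemma staircase_diag S i j : strict_up S -> j <= i -> j < n.+1 ->
  ~~ staircase S i j.
Proof.
move=> [Slt _] ji jN; apply/negP => /andP[iN]; rewrite leqNgt jN /=.
by move/Slt; rewrite !inordK //; lia.
Qed.

Lemma staircase_ord S (i j : 'I_n.+1) : staircase S i j = S i j.
Proof. by rewrite /staircase ltn_ord leqNgt ltn_ord /= !inord_val. Qed.

Lemma chain_staircase S m (i : 'I_n.+1) :
  chain n.+1 (staircase S) m.+1 i = [exists j, chain_rel S m i j].
Proof.
elim: m i => [|m IH] i.
  apply/hasP/existsP => [[y]|[j ij]].
    rewrite mem_iota => /andP[_ yN] /andP[iy _]; exists (Ordinal yN).
    by rewrite -staircase_ord.
  by exists (val j); rewrite ?mem_iota //= staircase_ord ltn_ord andbT.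
apply/hasP/existsP => [[y]|[j /existsP[k /andP[ik kj]]]].
  rewrite mem_iota => /andP[_ yN] /andP[iy cy].
  have /existsP[j yj] : [exists j, chain_rel S m (Ordinal yN) j] by rewrite -IH.
  exists j; apply/existsP; exists (Ordinal yN).
  by apply/andP; split=> //; rewrite -staircase_ord.
exists (val k); first by rewrite mem_iota /=.
apply/andP; rewrite staircase_ord; split=> //.
by rewrite -/(chain _ _ m.+1 k) IH; apply/existsP; exists j.
Qed.

Lemma bfs_staircase S K : strict_up S ->
  bfs K 1 0 (border (n.+1 + n.+1) (staircase S)) = ~~ chain n.+1 (staircase S) K 0.
Proof.
move=> Sup.
rewrite -(@bfs_border n.+1 (staircase S) _ _ _ K 0 0 0) ?subn0 ?subnn //.
- by move=> i j i' j' ii jj _ _; apply: staircase_mono.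
- by move=> i j; apply: staircase_diag.
by move=> i j iN jN; rewrite /staircase iN jN.
Qed.

(** By [chain_mono] a chain starting anywhere yields one of the same length starting at 0. *)
Lemma bfs_chain_rel S m : strict_up S ->
  bfs m.+1 1 0 (border (n.+1 + n.+1) (staircase S)) =
  ~~ [exists i, exists j, chain_rel S m i j].
Proof.
move=> Sup; rewrite bfs_staircase //; congr (~~ _); apply/idP/existsP=> [c0 | [x]].
  by exists ord0; rewrite -chain_staircase.
rewrite -chain_staircase; apply: chain_mono => //.
  by move=> *; apply: staircase_mono; eassumption.
by move=> *; apply: staircase_diag.
Qed.

(** The word is balanced by [bfs_count], and its region lies strictly above the diagonal by
    [bfs_cellF] with [a + b = 1]. *)
Lemma word_staircase K w : size w = n.+1 + n.+1 -> bfs K 1 0 w ->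
  exists2 S, strict_up S & border (n.+1 + n.+1) (staircase S) = w.
Proof.
move=> sw ok.
have cw : count negb w = n.+1 /\ count id w = n.+1.
  have := bfs_count ok isT; have := count_predC id w.
  by rewrite sw -[count (predC id) w]/(count negb w); lia.
case: cw => cN cI.
pose S (i j : 'I_n.+1) := cell w i j.
have wF i j : j < n.+1 -> j <= i -> ~~ cell w i j.
  by move=> jN ji; apply: (bfs_cellF ok) => //; rewrite ?cI; lia.
have Sup : strict_up S.
  split=> [i j|i j i' j' ij ii jj].
    by apply: contraTT; rewrite -leqNgt => ji; apply: wF.
  apply: cell_mono ij => //; rewrite sw.
  by have := ltn_ord i'; have := ltn_ord j'; lia.
exists S => //; rewrite -[RHS]cellK sw; apply: eq_border => i j ij.
(* Outside the square both sides are false in rows beyond [n] and true in columns beyond [n], the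
   word having [n + 1] letters of each kind. *)
rewrite /staircase /S; have [iN|Ni] := ltnP i n.+1 => /=; last first.
  by apply/esym/negbTE/wF; lia.
have [Nj|jN] := leqP n.+1 j; last by rewrite !inordK.
by apply/esym/cellT; rewrite ?cN ?cI.
Qed.

(** The [2n + 2] letters decide all cells with [i + j < 2n + 2], which include the whole square. *)
Lemma staircase_inj S T : strict_up S -> strict_up T ->
  border (n.+1 + n.+1) (staircase S) = border (n.+1 + n.+1) (staircase T) ->
  S =2 T.
Proof.
move=> Sup Tup e i j; rewrite -[LHS]staircase_ord -[RHS]staircase_ord.
have ij : i + j < n.+1 + n.+1 by have := ltn_ord i; have := ltn_ord j; lia.
rewrite -(@borderK (n.+1 + n.+1) (staircase S)) //; last first.
  by move=> *; apply: staircase_mono; eassumption.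
rewrite -(@borderK (n.+1 + n.+1) (staircase T)) ?e //.
by move=> *; apply: staircase_mono; eassumption.
Qed.

End Staircase.

Local Open Scope ring_scope.

(** * Diagonalization of a Cartan subalgebra *)

Lemma free_subseq_span (K : fieldType) (V : vectType K) (X : seq V) :
  exists Y, [/\ free Y, <<Y>>%VS = <<X>>%VS & {subset Y <= X}].
Proof.
elim: X => [|v X [Y [fY sY YX]]]; first by exists [::]; split=> //; rewrite nil_free.
have [vX|vX] := boolP (v \in <<X>>%VS).
  exists Y; split=> //; last by move=> y /YX yX; rewrite inE yX orbT.
  by rewrite sY span_cons; apply/esym/addv_idPr; rewrite -memvE.
exists (v :: Y); split; first by rewrite free_cons fY sY vX.
  by rewrite !span_cons sY.
by move=> y; rewrite !inE => /orP[->|/YX ->] //; rewrite orbT.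
Qed.

Lemma mxtrace_delta (K : pzSemiRingType) m (i j : 'I_m) :
  \tr (delta_mx i j : 'M[K]_m) = (i == j)%:R.
Proof.
rewrite /mxtrace (bigD1 i) //= big1 ?addr0 => [|k ki]; rewrite mxE ?eqxx //.
by rewrite (negPf ki).
Qed.

Section CartanSubalgebra.
Variables (C : numClosedFieldType) (n : nat).
Local Notation M := 'M[C]_n.+1.

(* For an eigenvector [v] of [x] and an eigenvector [y] of [ad x], [v *m y] is again
   an eigenvector of [x], and such vectors span. *)
Lemma ad_semisimple_diagonalizable (x : M) : ad_semisimple x -> diagonalizable x.
Proof.
case=> e /andP[/eqP spe fre] eige.
have [a /eigenvalueP[v vx vn0]] := eigenvalue_closed x (ltn0Sn n).
have /fin_all_exists[c ec] : forall j : 'I_(size e), exists c, lie x e`_j = c *: e`_j.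
  by move=> j; apply: eige; rewrite mem_nth.
(* From [v x = a v] and [[x, y] = c y] follows [v y x = (a - c) v y]; the value [a] serves scalar
   matrices [y]. *)
pose rs := undup (a :: [seq a - c j | j <- enum 'I_(size e)]).
have sup r (u : 'rV_n.+1) : r \in rs -> u *m x = r *: u ->
    (u <= \sum_(r <- rs) eigenspace x r)%MS.
  move=> rrs /eigenspaceP ur; apply: submx_trans ur _.
  by rewrite (big_rem r) //= addsmxSl.
have vfree : row_free v by rewrite /row_free rank_rV vn0.
apply/diagonalizablePeigen; exists rs; first exact: undup_uniq.
apply/eqmxP; rewrite submx1 /=; apply/rV_subP => u _.
(* A matrix sending the row [v] to the arbitrary row [u]. *)
pose y := pinvmx v *m u.
have -> : u = v *m y by rewrite mulmxA mulmxVp // mul1mx.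
(* The eigenvectors [e] only span [sl], so the scalar part carrying the trace is split off. *)
have [y0 [d [y0sl ->]]] : exists y0 d, y0 \in sl C n /\ y = y0 + d%:M.
  exists (y - (\tr y / n.+1%:R)%:M), (\tr y / n.+1%:R); rewrite subrK; split=> //.
  rewrite mem_sl linearB /= mxtrace_scalar -(mulr_natr (\tr y / _)) divfK ?subrr //.
  by rewrite pnatr_eq0.
have {y0sl} : y0 \in <<e>>%VS by rewrite spe.
move=> /(@coord_span _ _ _ (in_tuple e)) ->.
rewrite mulmxDr mul_mx_scalar addmx_sub ?scalemx_sub //; last first.
  by apply: sup vx; rewrite mem_undup mem_head.
rewrite mulmx_sumr summx_sub // => j _; rewrite -scalemxAr scalemx_sub //.
apply: (sup (a - c j)).
  by rewrite mem_undup inE (map_f (fun j => a - c j)) ?orbT // mem_enum.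
have := congr1 (mulmx v) (ec j); rewrite /lie mulmxBr !mulmxA vx -scalemxAl -scalemxAr.
by rewrite scalerBl => <-; rewrite opprB addrC subrK.
Qed.

(** * Conjugated matrix units and the diagonal torus *)

Section Conj.
Variables (P : M) (Pu : P \in unitmx).

Definition conjm (x : M) : M := P *m x *m invmx P.
Definition cdelta (i j : 'I_n.+1) : M := invmx P *m delta_mx i j *m P.

Fact conjm_is_linear : linear conjm.
Proof. by move=> a u v; rewrite /conjm mulmxDr mulmxDl -scalemxAr -scalemxAl. Qed.
HB.instance Definition _ := GRing.isLinear.Build C M M _ conjm conjm_is_linear.

Lemma conjmM x y : conjm (x *m y) = conjm x *m conjm y.
Proof. by rewrite /conjm !mulmxA mulmxKV. Qed.

Lemma conjm_lie x y : conjm (lie x y) = lie (conjm x) (conjm y).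
Proof. by rewrite /lie linearB /= !conjmM. Qed.

Lemma conjm_inj : injective conjm.
Proof.
move=> x y /(congr1 (fun z => invmx P *m z *m P)).
by rewrite /conjm !mulmxA mulVmx // !mul1mx !mulmxKV.
Qed.

Lemma conjm_tr x : \tr (conjm x) = \tr x.
Proof. by rewrite /conjm mxtrace_mulC mulmxA mulVmx // mul1mx. Qed.

Lemma conjm_cdelta i j : conjm (cdelta i j) = delta_mx i j.
Proof. by rewrite /conjm /cdelta !mulmxA mulmxV // mul1mx mulmxK. Qed.

Lemma cdelta_sum x : x = \sum_i \sum_j conjm x i j *: cdelta i j.
Proof.
apply: conjm_inj; rewrite linear_sum {1}[conjm x]matrix_sum_delta.
apply: eq_bigr => i _; rewrite linear_sum.
by apply: eq_bigr => j _; rewrite linearZ /= conjm_cdelta.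
Qed.

Definition supported (T : rel 'I_n.+1) : {vspace M} :=
  <<[seq cdelta p.1 p.2 | p <- enum [pred p : 'I_n.+1 * 'I_n.+1 | T p.1 p.2]]>>%VS.

Lemma cdelta_supported (T : rel _) i j : T i j -> cdelta i j \in supported T.
Proof.
move=> Tij; apply: memv_span; apply/mapP; exists (i, j) => //.
by rewrite mem_enum.
Qed.

Lemma supportedP (T : rel _) x :
  reflect (forall i j, conjm x i j != 0 -> T i j) (x \in supported T).
Proof.
apply: (iffP idP) => [xT i j|xT].
  apply: contraNT => nT.
  rewrite /supported in xT.
  set X := map _ _ in xT.
  have {xT} := @coord_span _ _ _ (in_tuple X) _ xT.
  move=> ->; rewrite linear_sum summxE big1 // => k _.
  rewrite linearZ mxE /=.
  have /mapP[p] : X`_k \in X by rewrite mem_nth.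
  rewrite mem_enum inE => Tp ->; rewrite conjm_cdelta mxE.
  case: andP => [[/eqP ip /eqP jp]|]; last by rewrite mulr0.
  by rewrite ip jp Tp in nT.
rewrite [x]cdelta_sum; apply: rpred_sum => i _; apply: rpred_sum => j _.
have [->|xij] := eqVneq (conjm x i j) 0; first by rewrite scale0r rpred0.
by rewrite rpredZ // cdelta_supported // xT.
Qed.

Lemma conjm_lie_diag x y i j : x \in supported (fun i j => i == j) ->
  conjm (lie x y) i j = (conjm x i i - conjm x j j) * conjm y i j.
Proof.
move=> /supportedP xD; rewrite conjm_lie /lie; move: (conjm x) (conjm y) xD => D Y xD.
have -> : D = diag_mx (\row_k D k k).
  apply/matrixP=> k l; rewrite !mxE; have [->|kl] := eqVneq k l; first by rewrite mulr1n.
  by rewrite mulr0n; apply/eqP; apply: contraNT kl; apply: xD.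
by rewrite mul_diag_mx mul_mx_diag !mxE !eqxx !mulr1n mulrBl [_ * D j j]mulrC.
Qed.

Lemma lie_diag_cdelta x i j : x \in supported (fun i j => i == j) ->
  lie x (cdelta i j) = (conjm x i i - conjm x j j) *: cdelta i j.
Proof.
move=> xD; apply: conjm_inj; apply/matrixP=> k l.
rewrite conjm_lie_diag // linearZ /= [RHS]mxE conjm_cdelta !mxE.
by case: andP => [[/eqP-> /eqP->]|]; rewrite ?mulr0.
Qed.

Definition torus : {vspace M} := (sl C n :&: supported (fun i j => i == j))%VS.

Lemma mem_torus x : reflect (\tr x = 0 /\ forall i j, i != j -> conjm x i j = 0)
  (x \in torus).
Proof.
rewrite memv_cap mem_sl.
apply: (iffP andP) => [[/eqP-> /supportedP xD]|[-> xD]]; split=> //.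
  by move=> i j; apply: contraNeq => /xD.
by apply/supportedP => i j; apply: contraR => /xD ->.
Qed.

Lemma toral_torus : toral torus.
Proof.
split; first exact: capvSl.
  apply/eqP; rewrite -subv0; apply/liev_subP => u v.
  rewrite !memv_cap memv0 => /andP[_ uD] /andP[_ vD].
  rewrite [v]cdelta_sum linear_sum big1 //= => i _; rewrite linear_sum big1 //= => j _.
  rewrite linearZ /= lie_diag_cdelta //; case: (eqVneq i j) => [->|ij].
    by rewrite subrr scale0r scaler0.
  have [->|/(supportedP _ _ vD)] := eqVneq (conjm v i j) 0; first by rewrite scale0r.
  by rewrite (negPf ij).
move=> x; rewrite memv_cap => /andP[_ xD].
(* [E_ij] off the diagonal and [E_ii - E_00] on it: traceless eigenvectors spanning [sl]. The one
   for [(0, 0)] vanishes, so a free subfamily is extracted. *)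
pose v (p : 'I_n.+1 * 'I_n.+1) := cdelta p.1 p.2 - cdelta ord0 ord0 *+ (p.1 == p.2).
have [e [fe se eX]] := free_subseq_span [seq v p | p : 'I_n.+1 * 'I_n.+1].
exists e; last first.
  move=> _ /eX/mapP[[i j] _ ->]; rewrite /v /=.
  exists (conjm x i i - conjm x j j); rewrite linearB linearMn /= !lie_diag_cdelta //.
  case: eqP => [->|_]; first by rewrite !subrr !scale0r mulr1n subr0.
  by rewrite !mulr0n !subr0.
rewrite /basis_of se fe andbT; apply/eqP/vspaceP => y; apply/idP/idP.
  move: y; apply/subvP/span_subvP => _ /mapP[[i j] _ ->]; rewrite /v /= mem_sl.
  rewrite -conjm_tr linearB linearMn /= !conjm_cdelta linearB linearMn /= !mxtrace_delta.
  by case: eqP; rewrite ?eqxx subrr.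
rewrite mem_sl -conjm_tr => /eqP ty.
have -> : y = \sum_i \sum_j conjm y i j *: v (i, j).
  rewrite /v [LHS]cdelta_sum; apply/eqP; rewrite -subr_eq0 -sumrB.
  rewrite (eq_bigr (fun i => conjm y i i *: cdelta ord0 ord0)).
    by rewrite -scaler_suml -/(mxtrace _) ty scale0r.
  move=> i _; rewrite -sumrB (bigD1 i) //= eqxx mulr1n -scalerBr subKr.
  rewrite big1 ?add0r ?addr0 // => j; rewrite eq_sym => /negPf ->.
  by rewrite mulr0n subr0 subrr.
apply: rpred_sum => i _; apply: rpred_sum => j _; apply: rpredZ.
by apply: memv_span; apply: (map_f v); rewrite mem_enum.
Qed.

End Conj.

(** Commuting diagonalizable matrices are simultaneously diagonalizable, so [h] lies in some
    [torus P], which is toral; maximality gives equality. *)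
Lemma cartan_torus (h : {vspace M}) : cartan h ->
  exists2 P : M, P \in unitmx & h = torus P.
Proof.
case=> -[hsl /eqP hh hss] hmax.
have [P Pu /allP hP] : codiagonalizable (vbasis h).
  apply/codiagonalizableP; split=> [x y /vbasis_mem xh /vbasis_mem yh|x /vbasis_mem xh].
    move: hh; rewrite -subv0 => /liev_subP/(_ x y xh yh).
    by rewrite memv0 subr_eq0 => /eqP.
  exact/ad_semisimple_diagonalizable/hss.
exists P => //; apply/esym/hmax; first exact: toral_torus.
apply/subvP => x xh; apply/mem_torus => //; split.
  by apply/eqP; rewrite -mem_sl; apply: subvP xh.
move=> i j ij; rewrite (coord_vbasis xh) linear_sum summxE big1 // => k _.
rewrite linearZ mxE /=.
have /hP : (vbasis h)`_k \in vbasis h by rewrite mem_nth ?size_tuple.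
move=> /is_diag_mxP; rewrite conjumx // => /(_ i j ij) ; rewrite /conjm => ->.
by rewrite mulr0.
Qed.

(** * Roots and the Borel subalgebra *)

Section Roots.
Variables (P : M) (Pu : P \in unitmx).

Definition torus_root_fun i j (t : subvs_of (torus P)) : C^o :=
  conjm P (vsval t) i i - conjm P (vsval t) j j.

Fact torus_root_fun_is_linear i j : linear (torus_root_fun i j).
Proof.
move=> a u v; rewrite /torus_root_fun !linearP !mxE scalerBr opprD addrACA.
by [].
Qed.
HB.instance Definition _ i j := GRing.isLinear.Build C _ _ _ (torus_root_fun i j)
  (torus_root_fun_is_linear i j).

Definition torus_root i j : weight (torus P) := linfun (torus_root_fun i j).

Lemma torus_rootE i j t :
  torus_root i j t = conjm P (vsval t) i i - conjm P (vsval t) j j.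
Proof. by rewrite lfunE. Qed.

Lemma torus_rootN i j : - torus_root i j = torus_root j i.
Proof. by apply/lfunP => t; rewrite opp_lfunE !torus_rootE opprB. Qed.

Lemma torus_rootD i j k : torus_root i j + torus_root j k = torus_root i k.
Proof. by apply/lfunP => t; rewrite add_lfunE !torus_rootE addrA subrK. Qed.

Lemma torus_root0 i : torus_root i i = 0.
Proof. by apply/lfunP => t; rewrite torus_rootE subrr lfunE. Qed.

Lemma torus_diag x : x \in torus P -> x \in supported P (fun i j => i == j).
Proof. by rewrite memv_cap => /andP[]. Qed.

(** At the coroot [E_ii - E_jj] the functional [e_i - e_j] takes the value 2, which no other
    [e_k - e_l] attains in characteristic 0. *)
Lemma torus_root_inj i j k l :
  i != j -> torus_root k l = torus_root i j -> k = i /\ l = j.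
Proof.
move=> ij e.
have ht : cdelta P i i - cdelta P j j \in torus P.
  rewrite memv_cap mem_sl -(conjm_tr Pu) linearB /= !conjm_cdelta // linearB /=.
  by rewrite !mxtrace_delta !eqxx subrr eqxx rpredB // cdelta_supported.
have := congr1 (fun f : weight _ => f (vsproj _ (cdelta P i i - cdelta P j j))) e.
rewrite !torus_rootE vsprojK // linearB /= !conjm_cdelta // !mxE !eqxx.
rewrite (negPf ij) [j == i]eq_sym (negPf ij) /= !andbb subr0 sub0r opprK => e2.
have : ((k == i) + (l == j))%:R = (2 + (k == j) + (l == i))%:R :> C.
  by rewrite !natrD -[2%:R]e2 /=; ring.
move/eqP; rewrite eqr_nat.
by case: eqP; case: eqP; case: eqP; case: eqP.
Qed.

Lemma root_space_conjm (al : weight (torus P)) x i j : x \in root_space al ->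
  conjm P x i j != 0 -> al = torus_root i j.
Proof.
move=> /mem_root_space[xsl lx] xij; apply/lfunP => t.
have := congr1 (fun y => conjm P y i j) (lx t).
rewrite conjm_lie_diag //; last exact/torus_diag/subvsP.
by rewrite linearZ /= [X in _ = X -> _]mxE => /(mulIf xij) <-; rewrite torus_rootE.
Qed.

Lemma cdelta_root_space i j : i != j -> cdelta P i j \in root_space (torus_root i j).
Proof.
move=> ij; apply/mem_root_space; split.
  by rewrite mem_sl -(conjm_tr Pu) conjm_cdelta // mxtrace_delta (negPf ij).
move=> t; rewrite torus_rootE; apply: lie_diag_cdelta => //; exact/torus_diag/subvsP.
Qed.

Lemma cdelta_neq0 i j : cdelta P i j != 0.
Proof.
apply/eqP => /(congr1 (fun y => conjm P y i j)).
rewrite conjm_cdelta // linear0 !mxE !eqxx => /eqP; by rewrite oner_eq0.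
Qed.

Lemma is_root_root i j : i != j -> is_root (torus_root i j).
Proof.
move=> ij; apply/andP; split.
  apply: contra_neq ij => r0.
  apply/eqP/negP => /negP ij.
  have [_ ] := torus_root_inj ij (etrans (torus_root0 i) (esym r0)).
  by move/eqP; apply/negP.
apply: contraNneq (cdelta_neq0 i j) => rs0.
by rewrite -memv0 -rs0 cdelta_root_space.
Qed.

(** Membership of [e_i - e_j] in [Dp] is a strict total order on the indices; [rk] counts
    predecessors. *)
Lemma borel_torus (Dp : seq (weight (torus P))) : positive_system Dp ->
  exists rk : {perm 'I_n.+1},
   borel Dp = (sl C n :&: supported P (fun i j => rk i <= rk j)%N)%VS.
Proof.
case=> Dr Dn Da.
pose lt i j := torus_root i j \in Dp.
have irr i : ~~ lt i i.
  by have := Dr 0; rewrite /lt torus_root0 /is_root eqxx /= => /esym/negbT/norP[].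
have tot i j : i != j -> lt i j || lt j i.
  by move=> ij; rewrite /lt -(torus_rootN i j) -Dr is_root_root.
have asym i j : lt i j -> ~~ lt j i by rewrite /lt -(torus_rootN i j); apply: Dn.
have tr i j k : lt i j -> lt j k -> lt i k.
  move=> ij jk; have ik : i != k.
    by apply: contraTneq jk => <-; apply: asym.
  by rewrite /lt -(torus_rootD i j k); apply: Da => //; rewrite torus_rootD is_root_root.
pose r i := #|[set j | lt j i]|.
have r_lt i : (r i < n.+1)%N.
  rewrite -[n.+1]card_ord -cardsT; apply/proper_card/fintype.properP; split.
    by apply/fintype.subsetP => j; rewrite inE.
  by exists i; rewrite !inE // irr.
have r_mono i j : lt i j -> (r i < r j)%N.
  move=> ij; apply/proper_card/fintype.properP; split.
    by apply/fintype.subsetP => k; rewrite !inE => /tr; apply.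
  by exists i; rewrite !inE // irr.
pose f i := Ordinal (r_lt i).
have f_inj : injective f.
  move=> i j /(congr1 val) /= rij; apply/eqP; apply: contraTT isT => ij.
  by case/orP: (tot _ _ ij) => /r_mono; rewrite rij ltnn.
have lt_r i j : i != j -> (r i <= r j)%N -> lt i j.
  move=> ij; apply: contraTT => nij; have := tot _ _ ij.
  by rewrite (negPf nij) /= -ltnNge; apply: r_mono.
exists (perm f_inj); apply/vspaceP => x; rewrite memv_cap.
apply/idP/andP => [|[xsl /(supportedP Pu) xu]].
  move=> xb; apply/andP; rewrite -memv_cap; move: x xb; apply/subvP.
  rewrite subv_add; apply/andP; split.
    apply/subvP => x xt; rewrite memv_cap (subvP (capvSl _ _) _ xt).
    apply/(supportedP Pu) => i j; have [->|ij] := eqVneq i j; first by rewrite leqnn.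
    by have [_ ->] := mem_torus Pu _ xt; rewrite ?eqxx.
  rewrite big_seq; elim/big_ind: _ => [|U V|al alD]; first exact: sub0v.
    by rewrite subv_add => -> ->.
  apply/subvP => x xal; rewrite memv_cap; have [-> _] := mem_root_space _ _ xal.
  apply/(supportedP Pu) => i j /(root_space_conjm xal) ea; rewrite !permE /=.
  by apply/ltnW/r_mono; rewrite /lt -ea.
rewrite [x](cdelta_sum Pu) (eq_bigr (fun i => conjm P x i i *: cdelta P i i +
  \sum_(j | j != i) conjm P x i j *: cdelta P i j)) => [|i _]; last by rewrite (bigD1 i).
rewrite big_split; apply: memv_add => /=.
  rewrite memv_cap mem_sl linear_sum; apply/andP; split; last first.
    by apply: rpred_sum => i _; apply/rpredZ/cdelta_supported.
  rewrite mem_sl -(conjm_tr Pu) in xsl; apply/eqP; rewrite -[RHS](eqP xsl).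
  apply: eq_bigr => i _; rewrite linearZ /= -(conjm_tr Pu) conjm_cdelta //.
  by rewrite mxtrace_delta eqxx mulr1.
apply: rpred_sum => i _; apply: rpred_sum => j ji.
have [->|xij] := eqVneq (conjm P x i j) 0; first by rewrite scale0r rpred0.
apply: rpredZ; have := xu _ _ xij; rewrite !permE /= => rij.
rewrite (big_rem (torus_root i j)) /=; last by apply: lt_r; rewrite // eq_sym.
by apply: (subvP (addvSl _ _)); apply: cdelta_root_space; rewrite eq_sym.
Qed.

End Roots.

(** The permutation ranking the indices is absorbed into the conjugating matrix. *)
Lemma borel_upper (h : {vspace M}) (Dp : seq (weight h)) :
  cartan h -> positive_system Dp ->
  exists2 P : M, P \in unitmx &
    borel Dp = (sl C n :&: supported P (fun i j => i <= j)%N)%VS.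
Proof.
move=> /cartan_torus[P Pu eh]; subst h => /(borel_torus Pu)[rk ->].
pose Q := perm_mx rk^-1%g *m P.
have Qu : Q \in unitmx by rewrite unitmx_mul unitmx_perm.
have cjQ x i j : conjm Q x i j = conjm P x ((rk^-1)%g i) ((rk^-1)%g j).
  have -> : conjm Q x = row_perm rk^-1%g (col_perm rk^-1%g (conjm P x)).
    rewrite row_permE col_permE invgK /conjm /Q.
    have -> : invmx (perm_mx rk^-1%g *m P) = invmx P *m perm_mx rk.
      by rewrite [LHS]invrM ?unitmx_perm // -perm_mxV invgK.
    by rewrite !mulmxA.
  by rewrite !mxE.
exists Q => //; apply/vspaceP => x; rewrite !memv_cap; congr (_ && _).
apply/(supportedP Pu)/(supportedP Qu) => xu i j.
  by rewrite cjQ => /xu; rewrite !permKV.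
by have := xu (rk i) (rk j); rewrite cjQ !permK.
Qed.

End CartanSubalgebra.

(** * Ad-nilpotent ideals *)

Lemma mulmx_neq0 (R : pzSemiRingType) m n p (A : 'M[R]_(m, n)) (B : 'M[R]_(n, p)) i j :
  (A *m B) i j != 0 -> exists k, A i k != 0 /\ B k j != 0.
Proof.
rewrite mxE => AB; have [k|AB0] := pickP (fun k => (A i k != 0) && (B k j != 0)).
  by case/andP; exists k.
move/eqP: AB; case; apply: big1 => k _; have /nandP[] := negbT (AB0 k);
  by rewrite negbK => /eqP->; rewrite ?mul0r ?mulr0.
Qed.

Lemma lie_neq0 (F : fieldType) n (A B : 'M[F]_n.+1) i j : lie A B i j != 0 ->
  (exists k, A i k != 0 /\ B k j != 0) \/ (exists k, B i k != 0 /\ A k j != 0).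
Proof.
rewrite /lie => AB; have [/mulmx_neq0|AB0] := boolP ((A *m B) i j != 0); first by left.
right; apply: mulmx_neq0; apply: contra AB => BA0; rewrite !mxE in AB0 BA0 *.
by move: AB0 BA0; rewrite negbK => /eqP-> /eqP->; rewrite subrr.
Qed.

Section Ideals.
Variables (C : numClosedFieldType) (n : nat).
Local Notation M := 'M[C]_n.+1.
Variables (P : M) (Pu : P \in unitmx).
Implicit Types (S : rel 'I_n.+1) (I : {vspace M}).

Local Notation upper := (sl C n :&: supported P (fun i j => i <= j)%N)%VS.

Lemma lie_cdelta i j k l : lie (cdelta P i j) (cdelta P k l) =
  cdelta P i l *+ (j == k) - cdelta P k j *+ (l == i).
Proof.
apply: (conjm_inj Pu); rewrite conjm_lie // !(linearB, linearMn) /= !conjm_cdelta // /lie.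
by rewrite !mul_delta_mx_cond mulNrn.
Qed.

Lemma mem_cdelta_supported S i j : (cdelta P i j \in supported P S) = S i j.
Proof.
apply/idP/idP => [/(supportedP Pu)/(_ i j)|]; last exact: cdelta_supported.
by rewrite conjm_cdelta // mxE !eqxx oner_eq0; apply.
Qed.

Lemma cdelta_upper (i j : 'I_n.+1) : (i < j)%N -> cdelta P i j \in upper.
Proof.
move=> ij; rewrite memv_cap mem_cdelta_supported (ltnW ij) andbT mem_sl.
by rewrite -(conjm_tr Pu) conjm_cdelta // mxtrace_delta -val_eqE ltn_eqF.
Qed.

(* [[E_jj, [E_ii, x]] = - x_ij E_ij] when [x] is upper triangular and [i < j]. *)
Lemma ideal_cdelta I x i j : ad_nilpotent_ideal upper I -> x \in I ->
  i != j -> conjm P x i j != 0 -> cdelta P i j \in I.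
Proof.
case=> /subvP Ib /liev_subP bI _ xI nij xij.
have /(supportedP Pu) xu : x \in supported P (fun i j => i <= j)%N.
  by have := Ib x xI; rewrite memv_cap => /andP[].
have ij : (i < j)%N by rewrite ltn_neqAle nij xu.
(* [E_kk] made traceless; the scalar correction does not affect brackets. *)
pose D k : M := cdelta P k k - (n.+1%:R^-1)%:M.
have cjD k : conjm P (D k) = delta_mx k k - (n.+1%:R^-1)%:M.
  rewrite linearB /= conjm_cdelta //; congr (_ - _).
  by rewrite /conjm scalar_mxC -mulmxA mulmxV // mulmx1.
have Dd k : D k \in supported P (fun i j => i == j).
  apply/(supportedP Pu) => a b; rewrite cjD !mxE; apply: contraR => ab.
  rewrite (negPf ab) subr0; case: andP => // -[/eqP ak /eqP bk].
  by rewrite ak bk eqxx in ab.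
have Db k : D k \in upper.
  rewrite memv_cap mem_sl -(conjm_tr Pu) cjD linearB /= mxtrace_delta mxtrace_scalar eqxx.
  rewrite -(mulr_natr (n.+1%:R^-1)) mulVf ?pnatr_eq0 // subrr eqxx /=.
  by apply/(supportedP Pu) => a b /(supportedP Pu _ _ (Dd k))/eqP->.
have DI k : {in I, forall y, lie (D k) y \in I} by move=> y; apply: bI.
have /(rpredZ (- (conjm P x i j)^-1)) := DI j _ (DI i _ xI).
congr (_ \in I); apply: (conjm_inj Pu); rewrite linearZ /= conjm_cdelta //.
apply/matrixP => a b; rewrite [LHS]mxE !conjm_lie_diag // !cjD.
move: (conjm P x) xij xu => c xij xu.
have [xab|/xu ab] := eqVneq (c a b) 0.
  rewrite xab !mulr0 mxE; case: andP => // -[/eqP ai /eqP bj].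
  by rewrite -ai -bj xab eqxx in xij.
(* The entry [(a, b)] gets the factor [(d_aj - d_bj)(d_ai - d_bi)], with [d] the Kronecker delta. It
   vanishes except at [(i, j)] and [(j, i)], and the latter lies below the diagonal. *)
rewrite !mxE !eqxx !mulr1n !andbb.
have [ea|_] := eqVneq a i; have [eb|_] := eqVneq b j; have [ea'|_] := eqVneq a j;
  have [eb'|_] := eqVneq b i; subst => /=; try (by ring); try (by move: ij ab; lia).
by move: (n.+1%:R^-1) => q; field.
Qed.

(** The diagonal part [d] of [x] lies in [I]. Since [ad d] scales [E_kl] by [x_kk - x_ll],
    nilpotency makes the diagonal constant, and trace 0 makes it zero. *)
Lemma ideal_diag I x i : ad_nilpotent_ideal upper I -> x \in I -> conjm P x i i = 0.
Proof.
move=> idI xI; case: (idI) => /subvP Ib _ Inil.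
pose d := \sum_i conjm P x i i *: cdelta P i i.
have dI : d \in I.
  have : x - \sum_i \sum_(j | j != i) conjm P x i j *: cdelta P i j \in I.
    rewrite rpredB //; apply: rpred_sum => k _; apply: rpred_sum => l kl.
    have [->|xkl] := eqVneq (conjm P x k l) 0; first by rewrite scale0r rpred0.
    by apply: rpredZ; apply: ideal_cdelta xkl => //; rewrite eq_sym.
  congr (_ \in I); apply/eqP; rewrite subr_eq -big_split /= {1}[x](cdelta_sum Pu).
  apply/eqP.
  by apply: eq_bigr => k _; rewrite [LHS](bigD1 k).
have dD : d \in supported P (fun i j => i == j).
  by apply: rpred_sum => k _; apply: rpredZ; apply: cdelta_supported.
have cjd k : conjm P d k k = conjm P x k k.
  rewrite linear_sum summxE (bigD1 k) //= big1 ?addr0 => [|l lk].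
    by rewrite linearZ [LHS]mxE /= conjm_cdelta // [delta_mx _ _ _ _]mxE !eqxx mulr1.
  rewrite linearZ [LHS]mxE /= conjm_cdelta // [delta_mx _ _ _ _]mxE eq_sym.
  by rewrite (negPf lk) mulr0.
have eqd k l : conjm P x k k = conjm P x l l.
  have [->//|kl] := eqVneq k l.
  have [m dm] := Inil d dI.
  have : cdelta P k l \in sl C n.
    by rewrite mem_sl -(conjm_tr Pu) conjm_cdelta // mxtrace_delta (negPf kl).
  move/dm; have -> : iter m (lie d) (cdelta P k l) =
      (conjm P x k k - conjm P x l l) ^+ m *: cdelta P k l.
    elim: m {dm} => [|m IH]; first by rewrite scale1r.
    by rewrite iterS IH linearZ /= lie_diag_cdelta // !cjd scalerA exprSr.
  move/eqP; rewrite scaler_eq0 (negPf (cdelta_neq0 Pu _ _)) orbF expf_eq0 subr_eq0.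
  by case/andP=> _ /eqP.
have : \tr x = 0 by have := Ib x xI; rewrite memv_cap mem_sl => /andP[/eqP].
rewrite -(conjm_tr Pu) /mxtrace (eq_bigr (fun=> conjm P x i i)) // sumr_const card_ord.
by move/eqP; rewrite -mulr_natr mulf_eq0 pnatr_eq0 orbF => /eqP.
Qed.

Definition delta_rel I : rel 'I_n.+1 := fun i j => cdelta P i j \in I.

Lemma delta_rel_lt I i j : ad_nilpotent_ideal upper I -> delta_rel I i j -> (i < j)%N.
Proof.
move=> idI ijI; have [/subvP Ib _ _] := idI.
have := Ib _ ijI; rewrite memv_cap mem_cdelta_supported leq_eqVlt => /andP[_ /orP[]//].
move/eqP/val_inj=> ij; have := ideal_diag i idI ijI.
by rewrite conjm_cdelta // mxE ij !eqxx => /eqP; rewrite oner_eq0.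
Qed.

Lemma ideal_supported I : ad_nilpotent_ideal upper I -> I = supported P (delta_rel I).
Proof.
move=> idI; apply/vspaceP => x; apply/idP/(supportedP Pu) => [xI i j xij|xS].
  apply: ideal_cdelta (xij) => //; apply: contraNneq xij => <-.
  by rewrite (ideal_diag _ idI).
rewrite [x](cdelta_sum Pu); apply: rpred_sum => i _; apply: rpred_sum => j _.
have [->|xij] := eqVneq (conjm P x i j) 0; first by rewrite scale0r rpred0.
exact/rpredZ/xS.
Qed.

(** Bracketing with [E_i'i] replaces the row [i] by [i'], and bracketing with [E_jj'] the column [j]
    by [j']. *)
Lemma delta_rel_up I : ad_nilpotent_ideal upper I -> strict_up (delta_rel I).
Proof.
move=> idI; split=> [i j|i j i' j' ijI ii jj]; first exact: delta_rel_lt.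
have lt_ij := delta_rel_lt idI ijI; have [_ /liev_subP bI _] := idI.
have i'j : delta_rel I i' j.
  move: ii; rewrite leq_eqVlt => /predU1P[/val_inj->//|ii].
  have := bI _ _ (cdelta_upper ii) ijI; rewrite lie_cdelta eqxx /delta_rel.
  have -> : (j == i') = false by apply/negbTE; rewrite -val_eqE /=; lia.
  by rewrite mulr1n mulr0n subr0.
move: jj; rewrite leq_eqVlt => /predU1P[/val_inj<-//|jj].
have lt_i'j := delta_rel_lt idI i'j.
have := bI _ _ (cdelta_upper jj) i'j; rewrite lie_cdelta eqxx /delta_rel.
have -> : (j' == i') = false by apply/negbTE; rewrite -val_eqE /=; lia.
by rewrite mulr1n mulr0n sub0r rpredN.
Qed.

Lemma supported_ideal S : strict_up S -> ad_nilpotent_ideal upper (supported P S).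
Proof.
case=> Slt Sup; split.
- apply/subvP => x /(supportedP Pu) xS; rewrite memv_cap mem_sl; apply/andP; split.
    rewrite -(conjm_tr Pu) /mxtrace big1 // => i _; apply/eqP.
    by apply: contraT => /xS/Slt; rewrite ltnn.
  by apply/(supportedP Pu) => i j /xS/Slt/ltnW.
- apply/liev_subP => u v; rewrite memv_cap.
  move=> /andP[_ /(supportedP Pu) uu] /(supportedP Pu) vS.
  apply/(supportedP Pu) => i j; rewrite conjm_lie // => /lie_neq0[] [k []].
    by move=> /uu ik /vS kj; apply: Sup kj ik _.
  by move=> /vS ik /uu kj; apply: Sup ik _ kj.
(* Each bracket with the strictly upper triangular [x] raises the least [j - i] in the support by at
   least 1, and [j - i] ranges from [-n] to [n]. *)
move=> x /(supportedP Pu) xS; exists (n + n).+1 => y _.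
apply: (conjm_inj Pu); rewrite linear0.
have H m i j : conjm P (iter m (lie x) y) i j != 0 -> (i + m <= j + n)%N.
  elim: m i j => [|m IH] i j; first by have := ltn_ord i; lia.
  rewrite iterS conjm_lie // => /lie_neq0[] [k [] h1 h2].
    by have := Slt _ _ (xS _ _ h1); have := IH _ _ h2; lia.
  by have := Slt _ _ (xS _ _ h2); have := IH _ _ h1; lia.
apply/matrixP => i j; rewrite [RHS]mxE; apply/eqP; apply: contraT => /H.
by have := ltn_ord j; lia.
Qed.

(** For [i < k < j] the bracket of [E_kj] with [E_ik] is [- E_ij], so brackets of matrix units
    concatenate chains without cancellation. *)
Lemma liepow_supported S m : strict_up S ->
  liepow (supported P S) m = supported P (chain_rel S m).
Proof.
move=> Sup; elim: m => [|m IH] //; rewrite /liepow iterS -/(liepow _ m) IH.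
apply/eqP; rewrite eqEsubv; apply/andP; split.
  apply/liev_subP => u v /(supportedP Pu) um /(supportedP Pu) vS.
  apply/(supportedP Pu) => i j; rewrite conjm_lie // => /lie_neq0[] [k []].
    by move=> /um ik /vS; apply: chain_relSr.
  by move=> /vS ik /um kj; apply/existsP; exists k; rewrite ik.
apply/span_subvP => _ /mapP[[i j] + ->] /=; rewrite mem_enum inE /=.
case/existsP => k /andP[ik kj].
have := liev_subP _ _ _ (subvv _) _ _ (cdelta_supported P kj) (cdelta_supported P ik).
rewrite lie_cdelta eqxx mulr1n.
have -> : (j == i) = false.
  apply/negbTE; rewrite -val_eqE /=.
  by have := Sup.1 _ _ ik; have := chain_rel_lt Sup kj; lia.
by rewrite mulr0n sub0r rpredN.
Qed.

Lemma supported_eq0 S : (supported P S == 0%VS) = ~~ [exists i, exists j, S i j].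
Proof.
apply/eqP/existsPn => [S0 i|S0].
  apply/existsPn => j; apply/negP => ij; have := cdelta_neq0 Pu i j.
  by rewrite -memv0 -S0 cdelta_supported.
apply/eqP; rewrite -subv0; apply/span_subvP => _ /mapP[[i j] + ->] /=.
by rewrite mem_enum inE /= => ij; case/negP: (S0 i); apply/existsP; exists j.
Qed.

End Ideals.

(** [liepow _ m] vanishes exactly when [m + 1] levels suffice for the border word. *)
Lemma nilpotence_class_bfs (C : numClosedFieldType) n (P : 'M[C]_n.+1)
    (S : rel 'I_n.+1) k : P \in unitmx -> strict_up S ->
  nilpotence_class (supported P S) k <->
  bfs k.+1 1 0 (border (n.+1 + n.+1)%N (staircase S)) &&
    ~~ bfs k 1 0 (border (n.+1 + n.+1)%N (staircase S)).
Proof.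
move=> Pu Sup; set w := border _ _.
have pow m : (liepow (supported P S) m == 0%VS) = bfs m.+1 1 0 w.
  by rewrite liepow_supported // supported_eq0 // bfs_chain_rel.
split=> [[/eqP]|/andP[wk wk']].
  rewrite pow => -> low /=; case: k low => [|k] low; last first.
    by rewrite -pow; apply: low.
  (* Case [k = 0]: with no level below the root only the empty word is accepted. *)
  have : size w = (n.+1 + n.+1)%N by rewrite size_border.
  by case: w {pow low} => [|[]].
split; first by apply/eqP; rewrite pow.
by move=> l lk; rewrite pow; apply: contra wk'; apply: bfs_leq.
Qed.

(** * Counting ideals by their border words *)

Local Open Scope complex_scope.
Local Open Scope classical_set_scope.
Local Open Scope card_scope.

Theorem theorem4p4 (R : realType) (n k : nat)
    (h : {vspace 'M[R[i]]_n.+1}) (Dp : seq (weight h)) :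
  (1 <= n)%N -> cartan h -> positive_system Dp ->
  [set I : {vspace 'M[R[i]]_n.+1} |
     ad_nilpotent_ideal (borel Dp) I /\ nilpotence_class I k]
  #= `I_(#|[set p : (2 * n + 2).-tuple bool |
             dyck p && (dyck_height p == k.+1)]%SET|).
Proof.
move=> _ hc Dps; have [P Pu ->] := borel_upper hc Dps.
rewrite -card_bfs_dyck.
set W := finset _.
have eN : (n.+1 + n.+1 = 2 * n + 2)%N by lia.
pose wd (I : {vspace 'M[R[i]]_n.+1}) :=
  border (n.+1 + n.+1) (staircase (delta_rel P I)).
have swd I : size (wd I) == (2 * n + 2)%N by rewrite size_border eN.
pose wt I : (2 * n + 2).-tuple bool := Tuple (swd I).
set A := [set I | _].
have AW I : A I -> wt I \in W.
  case=> idI; rewrite {1}(ideal_supported Pu idI) => /(nilpotence_class_bfs _ Pu).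
  by rewrite inE; apply; apply: (delta_rel_up Pu).
have wt_inj : {in A &, injective wt}.
  move=> I J /set_mem[idI _] /set_mem[idJ _] /(congr1 val) /= e.
  rewrite (ideal_supported Pu idI) (ideal_supported Pu idJ).
  have eIJ := staircase_inj (delta_rel_up Pu idI) (delta_rel_up Pu idJ) e.
  by apply/vspaceP => x; apply/(supportedP Pu)/(supportedP Pu) => xS i j /xS; rewrite eIJ.
have wt_surj w : w \in W -> exists2 I, A I & wt I = w.
  rewrite inE => /andP[w1 w2].
  have sw : size w = (n.+1 + n.+1)%N by rewrite size_tuple.
  have [S Sup Sw] := word_staircase sw w1.
  have idS := supported_ideal Pu Sup.
  exists (supported P S).
    by split=> //; apply/(nilpotence_class_bfs _ Pu Sup); rewrite Sw w1.
  apply: val_inj; rewrite /= -Sw; apply: eq_border => i j _.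
  by rewrite /staircase /delta_rel mem_cdelta_supported.
(* Positions in [enum W] turn the bijection [wt] from [A] to [W] into one onto an initial segment of
   the naturals. *)
pose f I := index (wt I) (enum W).
have f_inj : {in A &, injective f}.
  move=> I J IA JA; rewrite /f => e; apply: wt_inj => //.
  rewrite -[LHS](@nth_index _ (wt I) _ (enum W)) ?mem_enum ?AW //; last exact: set_mem.
  rewrite e [LHS]nth_index // mem_enum; apply: AW; exact: set_mem.
have <- : f @` A = `I_#|W|.
  apply/seteqP; split=> [_ [I IA <-]|m mW] /=.
    by rewrite cardE index_mem mem_enum AW.
  rewrite cardE /= in mW.
  have [I IA wI] : exists2 I, A I & wt I = nth (wt 0%VS) (enum W) m.
    by apply: wt_surj; rewrite -mem_enum mem_nth.
  by exists I => //; rewrite /f wI index_uniq // enum_uniq.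
by rewrite card_eq_sym; apply: inj_card_eq.
Qed.
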